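(* Let $I$ and $J$ be compositions of $n$, and let $\mathrm{PP}(I,J)$ be the set of permutations $\sigma\in S_n$ with $\mathrm{LC}(\sigma)=I$ and whose recoil composition is coarser than or equal to $J$. Then the coefficient $E_I^J(q)$ of $L_I(q)$ in $S^J(q)$ is \[ E_I^J(q)=q^{-\mathrm{maj}(\bar I)}\sum_{\sigma\in\mathrm{PP}(I,J)}q^{\mathrm{inv}(\sigma)}. \]
   Context: Compositions: $I=(i_1,\dots,i_r)$ positive integers summing to $n$; $\mathrm{Des}(I)=\{i_1,\dots,i_1+\dots+i_{r-1}\}$; $I\preceq J$ ($I$ finer, $J$ coarser) iff $\mathrm{Des}(I)\supseteq\mathrm{Des}(J)$; $\bar I=(i_r,\dots,i_1)$; $\mathrm{maj}(I)=\sum_{t=1}^r(r-t)i_t$; for $I\preceq J$, $\mathrm{st}(I,J)=\#\{(a,b)\in\mathrm{Des}(I)\times\mathrm{Des}(J):a\ge b\}$. For $\sigma\in S_n$: $\mathrm{inv}(\sigma)$ is its number of inversions; its recoil composition is the composition of $n$ with descent set $\{i:\sigma^{-1}(i)>\sigma^{-1}(i+1)\}$. $\mathrm{LC}(\sigma)$: let $c_i$ be the number of letters of $\sigma$ to the left of $i$ and greater than $i$; start with $S=\emptyset$ and for $t=n,n-1,\dots,1$, if $c_t>|S|$ add to $S$ the $(c_t-|S|)$-th smallest element of $\{1,\dots,n\}\setminus S$; the final $S$ is the descent set of a composition $C$ of $n$, and $\mathrm{LC}(\sigma)=\bar C$. Algebraic setting over $\mathbb K(q)$ ($\mathrm{char}\,\mathbb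 K=0$): packed words are words whose letter set is $\{1,\dots,m\}$; $\mathrm{pack}$ replaces the $t$-th smallest letter by $t$. For a packed word $w$ of length $n$: $\mathrm{WC}(w)$ is the composition of $n$ whose descent set is the set of positions $p<n$ with $w_p$ not occurring in $w_{p+1}\cdots w_n$; $\mathrm{sinv}(w)=\#\{i<j:w_i>w_j,\ w_j\text{ not occurring in }w_{j+1}\cdots w_n\}$. $\mathbf{WQSym}$ has basis $\mathbf M_u$ ($u$ packed) with $\mathbf M_{u'}\mathbf M_{u''}=\sum\mathbf M_u$ over packed $u=v\cdot w$ with $\mathrm{pack}(v)=u'$, $\mathrm{pack}(w)=u''$; $\mathbf M_{u'}\star_q\mathbf M_{u''}=\sum q^{\mathrm{sinv}(u)-\mathrm{sinv}(u')-\mathrm{sinv}(u'')}\mathbf M_u$ (associative). $\mathbf{Sym}$ is the quotient by the span of $\mathbf M_u-\mathbf M_v$ with $\mathrm{WC}(u)=\mathrm{WC}(v)$, $\zeta$ the quotient map, $\Psi_I=\zeta(\mathbf M_u)$ for $\mathrm{WC}(u)=I$ (a basis). $\tilde S_m=\sum\mathbf M_u$ over nondecreasing packed $u$ of length $m$; $S^J(q)=\zeta(\tilde S_{j_1}\star_q\cdots\star_q\tilde S_{j_l})$; $L_J(q)=\sum_{I\preceq J}q^{\mathrm{st}(I,J)}\Psi_I$ (a basis). *)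

(* Defs.v *)
From HB Require Import structures.
From mathcomp Require Import all_boot all_order all_algebra all_fingroup.
Set Implicit Arguments. Unset Strict Implicit. Unset Printing Implicit Defensive.
Import Order.TTheory GRing.Theory Num.Theory.

Definition is_comp (n : nat) (I : seq nat) : bool :=
  all (fun i => 0 < i) I && (sumn I == n).

Definition des (I : seq nat) : seq nat := take (size I).-1 (scanl addn 0 I).

Definition finer (I J : seq nat) : bool := all (fun d => d \in des I) (des J).

Definition comp_of_des (n : nat) (D : seq nat) : seq nat :=
  if n is 0 then [::]
  else pairmap (fun a b => b - a) 0 (rcons (sort leq (undup D)) n).

Definition crev (I : seq nat) : seq nat := rev I.

Definition maj (I : seq nat) : nat :=
  \sum_(t < size I) (size I - t.+1) * nth 0 I t.

Definition st (I J : seq nat) : nat :=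
  \sum_(a <- des I) count (fun b => b <= a) (des J).

Fixpoint compsF (fuel n : nat) : seq (seq nat) :=
  match fuel with
  | 0 => if n == 0 then [:: [::]] else [::]
  | fuel'.+1 =>
      if n == 0 then [:: [::]]
      else flatten [seq [seq k :: c | c <- compsF fuel' (n - k)] | k <- iota 1 n]
  end.
Definition comps (n : nat) : seq (seq nat) := compsF n n.

(* ---------- Permutations: σ ∈ S_n is a {perm 'I_n}; value k : 'I_n stands
   for the letter k+1, position p : 'I_n for position p+1. ---------- *)

Definition inv_perm {n} (s : 'S_n) : nat :=
  #|[set ij : 'I_n * 'I_n | (ij.1 < ij.2) && (s ij.2 < s ij.1)]|.

Definition recoil {n} (s : 'S_n) : seq nat :=
  comp_of_des n [seq i <- iota 1 n.-1 |
     [exists p : 'I_n, exists p' : 'I_n,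
        (p < p') && (val (s p) == i) && (val (s p') == i.-1)]].
(* value i is the letter i+1, value i.-1 the letter i: the letter i+1 occurs
   strictly before the letter i, i.e. σ^{-1}(i) > σ^{-1}(i+1) *)

(* c_t for letter t (1-indexed): number of letters left of t greater than t *)
Definition cLC {n} (s : 'S_n) (t : nat) : nat :=
  #|[set p : 'I_n | [exists p' : 'I_n,
        (val (s p') == t.-1) && (p < p') && (t.-1 < s p)]]|.

Definition LCstep {n} (s : 'S_n) (t : nat) (S : seq nat) : seq nat :=
  if size S < cLC s t then
    rcons S (nth 0 [seq x <- iota 1 n | x \notin S] (cLC s t - size S).-1)
  else S.

Definition LCset {n} (s : 'S_n) : seq nat :=
  foldl (fun S t => LCstep s t S) [::] (rev (iota 1 n)).

Definition LC {n} (s : 'S_n) : seq nat := crev (comp_of_des n (LCset s)).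

Definition PP (n : nat) (I J : seq nat) : {set 'S_n} :=
  [set s : 'S_n | (LC s == I) && finer J (recoil s)].

Definition packed (w : seq nat) : bool :=
  (0 \notin w) && all (fun k => k \in w) (iota 1 (\max_(x <- w) x)).

Definition pack (w : seq nat) : seq nat :=
  [seq (index x (sort leq (undup w))).+1 | x <- w].

Definition WC (w : seq nat) : seq nat :=
  comp_of_des (size w)
    [seq p <- iota 1 (size w).-1 | nth 0 w p.-1 \notin drop p w].

Definition sinv (w : seq nat) : nat :=
  \sum_(j < size w) \sum_(i < size w)
     ((i < j) && (nth 0 w j < nth 0 w i) && (nth 0 w j \notin drop j.+1 w) : nat).

Section Alg.
Variable K : fieldType.
Local Open Scope ring_scope.

Definition Kq := {fraction {poly K}}.
Definition q : Kq := tofrac ('X : {poly K}).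

(* homogeneous elements of WQSym: coefficient functions u |-> coefficient of M_u
   (supported on packed words of a fixed length) *)
Definition WQ := seq nat -> Kq.

Definition WQone : WQ := fun u => (u == [::])%:R.

(* f ⋆_q g for f homogeneous of degree a: coefficient of M_u is
   q^{sinv u - sinv u' - sinv u''} f(u') g(u'') where u = v.w, |v| = a,
   u' = pack v, u'' = pack w. *)
Definition qstar (a : nat) (f g : WQ) : WQ := fun u =>
  if packed u then
    q ^ ((sinv u)%:Z - (sinv (pack (take a u)))%:Z - (sinv (pack (drop a u)))%:Z)
      * f (pack (take a u)) * g (pack (drop a u))
  else 0.

Definition Stilde (m : nat) : WQ := fun u =>
  (packed u && sorted leq u && (size u == m))%:R.

Fixpoint Sprod (J : seq nat) : WQ :=
  if J is j :: J' then qstar j (Stilde j) (Sprod J') else WQone.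

(* elements of Sym_n: coefficient functions I |-> coefficient of Psi_I *)
Definition Sym := seq nat -> Kq.

(* ζ restricted to degree n: ζ(M_u) = Psi_{WC(u)}; packed words of length n
   are exactly the packed words in {1..n}^n *)
Definition word_of {n} (t : n.-tuple 'I_n) : seq nat := [seq (val i).+1 | i <- t].

Definition zeta (n : nat) (f : WQ) : Sym := fun I =>
  \sum_(t : n.-tuple 'I_n | packed (word_of t) && (WC (word_of t) == I))
     f (word_of t).

Definition SJ (J : seq nat) : Sym := zeta (sumn J) (Sprod J).

Definition LJ (J : seq nat) : Sym := fun I =>
  if finer I J then q ^+ st I J else 0.

End Alg.

(* Main.v *)
Require Import Defs.
From HB Require Import structures.
From mathcomp Require Import all_boot all_order all_algebra all_fingroup.
From mathcomp Require Import zify.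
Import Order.TTheory GRing.Theory Num.Theory.

Set Implicit Arguments. Unset Strict Implicit. Unset Printing Implicit Defensive.

(** Both sides are generating functions of codes, built from right to left.

    In [S^J(q)] the coefficient of [Psi_H] is the sum of [q^sinv(u)] over the
    packed words [u] with [WC u = H] that are nondecreasing on the blocks of [J].
    Let [d_i] be the number of distinct letters to the right of position [i] that
    are smaller than [u_i].  Then [sinv u] is the sum of the [d_i], one has
    [u_i <= u_(i+1)] iff [d_i <= d_(i+1)], and [u] is determined by [d], whose only
    constraint is [0 <= d_i <= #{l in Des H : l >= i}].

    On the other side a permutation is encoded by the Lehmer code [c] of its
    inverse, with [0 <= c_i <= n - i], and [LC] is computed from [c] by growing a
    set [S].  Put [D := {n - l : l in Des H}].  When [S] stays inside [D], which
    says that [LC] is coarser than [H], replace every [c_t > |S|] by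
    [d_t := |S| + #{l in D \ S : l <= x}], where [x] is the element added to [S] at
    that step, and every [c_t <= |S|] by [d_t := c_t].  This is a bijection onto the
    codes of the first kind; it preserves the comparison of consecutive entries, and
    [c_t - d_t = x - #{l in D : l <= x}], which sums to [maj - st].

    Positions are counted from the right below: the entry of a code followed by [m]
    entries is the one at position [n - m], so that all bounds are functions of the
    length of the tail. *)

(** * Codes of words *)

Fixpoint code (u : seq nat) : seq nat :=
  if u is x :: u' then count (fun y => y < x) (undup u') :: code u' else [::].

(** The final letter is always a last occurrence although [D 0] is false in the applications; hence
    the exemption for an empty tail. *)
Fixpoint lastpat (D : pred nat) (u : seq nat) : bool :=
  if u is x :: u' then
    ((u' == [::]) || ((x \notin u') == D (size u'))) && lastpat D u'
  else true.

(** At a position marked by [D] the letter is new, and [bump] makes room for it in the tail;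
    elsewhere it is the letter of rank [y.+1] already present there. *)
Fixpoint decode (D : pred nat) (d : seq nat) : seq nat :=
  if d is y :: d' then
    y.+1 :: (if D (size d') then map (bump y.+1) (decode D d') else decode D d')
  else [::].

Definition cbound (D : pred nat) (m : nat) : nat := count D (iota 1 m).

Fixpoint is_code (b : nat -> nat) (d : seq nat) : bool :=
  if d is y :: d' then (y <= b (size d')) && is_code b d' else true.

Fixpoint codes (b : nat -> nat) (m : nat) : seq (seq nat) :=
  if m is m'.+1 then [seq x :: c | c <- codes b m', x <- iota 0 (b m').+1]
  else [:: [::]].

(** Distinct letters are counted by last occurrences: the marked positions and the final one. *)
Definition nletters (D : pred nat) (m : nat) : nat :=
  if m is m'.+1 then (cbound D m').+1 else 0.

Lemma cboundS D m : cbound D m.+1 = cbound D m + D m.+1.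
Proof. by rewrite /cbound -[m.+1]addn1 iotaD count_cat /= addn0 add1n addn1. Qed.

Lemma size_code u : size (code u) = size u.
Proof. by elim: u => //= x u ->. Qed.

Lemma size_decode D d : size (decode D d) = size d.
Proof. by elim: d => //= y d IH; case: ifP => _; rewrite ?size_map IH. Qed.

Lemma bump_inj h : injective (bump h).
Proof. exact: can_inj (bumpK h). Qed.

Lemma code_bump h u : code (map (bump h) u) = code u.
Proof.
elim: u => //= x u ->; congr cons.
rewrite (undup_map_inj (@bump_inj h)) count_map; apply: eq_count => y /=.
by rewrite /bump; lia.
Qed.

Lemma lastpat_map_inj D f u : injective f -> lastpat D (map f u) = lastpat D u.
Proof.
move=> fi; elim: u => //= x u ->; rewrite size_map mem_map //.
by case: u.
Qed.

Lemma count_undup_iota (a : pred nat) u k :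
  u =i iota 1 k -> count a (undup u) = count a (iota 1 k).
Proof.
move=> h; move: a; apply/seq.permP/uniq_perm; rewrite ?undup_uniq ?iota_uniq // => x.
by rewrite mem_undup h.
Qed.

Lemma count_lt_iota y k : y <= k -> count (fun z => z < y.+1) (iota 1 k) = y.
Proof.
move=> le_yk; rewrite -(subnKC le_yk) iotaD count_cat.
rewrite (_ : count _ (iota 1 y) = y); last first.
  rewrite -[RHS](size_iota 1 y); apply/eqP; rewrite -all_count.
  by apply/allP => z; rewrite mem_iota; lia.
rewrite (_ : count _ _ = 0) ?addn0 //; apply/eqP; rewrite eqn0Ngt -has_count.
by apply/hasPn => z; rewrite mem_iota; lia.
Qed.

Section Decode.
Variable D : pred nat.
Hypothesis D0 : D 0 = false.

(** A new letter may exceed every letter of the tail, an old one at most all but itself; [cbound]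
    covers both cases. *)
Lemma cbound_nletters m : cbound D m = if D m then nletters D m else (nletters D m).-1.
Proof. by case: m => [|m] /=; rewrite ?D0 // cboundS; case: (D _); lia. Qed.

Lemma decode_mem d : is_code (cbound D) d -> decode D d =i iota 1 (nletters D (size d)).
Proof.
elim: d => [|y d IH] //= /andP[ley /IH{}IH] z.
rewrite -/(iota 1 (cbound D (size d)).+1) mem_iota; move: ley (IH); rewrite inE cbound_nletters.
case: ifP => Dm ley IHz.
  apply/orP/idP => [[/eqP->|/mapP[w]]|]; first lia.
    by rewrite IHz mem_iota => hw ->; rewrite /bump; lia.
  case: (eqVneq z y.+1) => [|ne] hz; [by left|right].
  rewrite -[z](@unbumpK y.+1) ?inE ?mem_map //; last exact: bump_inj.
  by rewrite IHz mem_iota /unbump; lia.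
rewrite IHz mem_iota; case: (size d) => [|m] /= in ley *; lia.
Qed.

Lemma code_decode d : is_code (cbound D) d -> code (decode D d) = d.
Proof.
elim: d => [|y d IH] //= /andP[ley hd]; have := count_undup_iota _ (decode_mem hd).
move: ley; rewrite cbound_nletters; case: ifP => Dm ley hc.
  rewrite code_bump IH // (undup_map_inj (@bump_inj y.+1)) count_map.
  rewrite -[in RHS](count_lt_iota ley) -hc; congr cons.
  by apply: eq_count => z /=; rewrite /bump; lia.
by rewrite IH // hc count_lt_iota //; lia.
Qed.

Lemma lastpat_decode d : is_code (cbound D) d -> lastpat D (decode D d).
Proof.
elim: d => [|y d IH] //= /andP[ley hd]; have hm := decode_mem hd.
move: ley; rewrite cbound_nletters; case: ifP => Dm ley.
  rewrite lastpat_map_inj; last exact: bump_inj.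
  rewrite IH // andbT size_map size_decode Dm; apply/orP; right; apply/eqP.
  by apply/mapP => -[z _ /eqP]; rewrite (negPf (neq_bump _ _)).
rewrite IH // andbT size_decode Dm -size_eq0 size_decode hm mem_iota.
by case: (size d) ley => [|m] //=; lia.
Qed.

(** A repeated first letter leaves a tail with the same letters. A new one is removed by closing its
    gap in the tail with [unbump], which changes neither the code nor the pattern. *)
Lemma decode_code u k : lastpat D u -> u =i iota 1 k ->
  is_code (cbound D) (code u) /\ decode D (code u) = u.
Proof.
have klem d k' : is_code (cbound D) d -> decode D d =i iota 1 k' -> k' = nletters D (size d).
  move=> hd h1; rewrite -(size_iota 1 k') -(size_iota 1 (nletters _ _)).
  apply/perm_size/uniq_perm; rewrite ?iota_uniq // => z.
  by rewrite -h1 decode_mem.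
(* A new letter leads to the shifted tail [w], which is not a subterm, so the induction is on a
   bound for the length. *)
move: {2}(size u) (leqnn (size u)) => N; elim: N u k => [|N IH] [|x u] k //=.
rewrite ltnS => leN /andP[hx pu] hk.
have xk : x \in iota 1 k by rewrite -hk mem_head.
case: (boolP (x \in u)) hx => xu hx.
  have hu : u =i iota 1 k.
    by move=> z; rewrite -hk inE; case: eqVneq => // ->.
  have [ic de] := IH u k leN pu hu.
  have kE : k = nletters D (size u).
    by rewrite -(size_code u); apply: klem => //; rewrite de.
  have Dm : D (size u) = false.
    by case: (u) xu hx => //= *; apply/esym/eqP.
  rewrite (count_undup_iota _ hu).
  move: xk; rewrite mem_iota => xk; case: x xk {hx hk xu} => [|x] xk; first lia.
  rewrite count_lt_iota; last lia.
  by rewrite ic size_code Dm de cbound_nletters Dm -kE; split => //; lia.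
pose w := map (unbump x) u.
have uw : u = map (bump x) w.
  rewrite -map_comp -[LHS]map_id; apply/eq_in_map => z zu /=; rewrite unbumpK //.
  by rewrite !inE; apply: contraNneq xu => <-.
have hw : w =i iota 1 k.-1.
  move=> z; rewrite -(mem_map (@bump_inj x)) -uw.
  have : (bump x z \in x :: u) = (bump x z \in u).
    by rewrite inE eq_sym (negPf (neq_bump _ _)).
  by rewrite hk => <-; move: xk; rewrite !mem_iota /bump; lia.
have sw : size w = size u by rewrite size_map.
have [||ic de] := IH w k.-1 _ _ hw.
- by rewrite sw.
- by rewrite -(@lastpat_map_inj D (bump x)) -?uw //; exact: bump_inj.
have kE : k.-1 = nletters D (size u).
  by rewrite -sw -(size_code w); apply: klem => //; rewrite de.
have ee : code u = code w by rewrite uw code_bump.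
have cE : count (fun y => y < x) (undup u) = x.-1.
  rewrite uw (undup_map_inj (@bump_inj x)) count_map.
  rewrite -(@eq_count _ (fun y => y < x.-1.+1)) => [|z /=]; last first.
    by move: xk; rewrite mem_iota /bump; lia.
  rewrite (count_undup_iota _ hw) count_lt_iota //.
  by move: xk; rewrite mem_iota; lia.
rewrite cE ee ic size_code sw.
(* With an empty tail the only letter is 1, and [D0] selects the branch of [decode] without a
   shift. *)
case: (eqVneq u [::]) hx => [u0|un] /= hx.
  move: hk xk; rewrite u0 => hk; rewrite mem_iota => xk.
  have : 1 \in iota 1 k by rewrite mem_iota; lia.
  by rewrite -hk inE => /eqP <-; rewrite D0; case: (w) (sw); rewrite u0.
have Dm : D (size u) by rewrite -(eqP hx).
rewrite Dm de cbound_nletters Dm -kE.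
have -> : x.-1.+1 = x by move: xk; rewrite mem_iota; lia.
by rewrite -uw andbT; split => //; move: xk; rewrite mem_iota; lia.
Qed.

End Decode.

(** * Inversions and adjacent comparisons read off the code *)

Lemma count_undup_nth (a : pred nat) u :
  count a (undup u) =
  \sum_(j < size u) (a (nth 0 u j) && (nth 0 u j \notin drop j.+1 u) : nat).
Proof.
elim: u => [|x u IH]; first by rewrite big_ord0.
rewrite [RHS]big_ord_recl /= drop0 -IH; case: ifP => xu /=; first by rewrite andbF.
by rewrite andbT.
Qed.

(** For a fixed left end, the pairs in [sinv] have right ends at last occurrences, one for each
    distinct smaller letter to the right. *)
Lemma sinvE u : sinv u = sumn (code u).
Proof.
elim: u => [|x u IH]; first by rewrite /sinv big_ord0.
rewrite /= -IH count_undup_nth /sinv big_ord_recl big1 ?add0n; last first.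
  by move=> i _; rewrite ltn0.
rewrite -big_split; apply: eq_bigr => j _.
by rewrite big_ord_recl; congr (_ + _).
Qed.

Lemma nth_code u i : i < size u ->
  nth 0 (code u) i = count (fun y => y < nth 0 u i) (undup (drop i.+1 u)).
Proof. by elim: u i => // x u IH [|i] /= hi; [rewrite drop0|exact: IH]. Qed.

(** Let [x], [y] be the two letters. If [x <= y], then [y] is not counted for [x] and all letters
    below [x] are below [y]; if [y < x], then [y] itself is an extra letter counted for [x]. *)
Lemma code_adjacent u i : i.+1 < size u ->
  (nth 0 (code u) i <= nth 0 (code u) i.+1) = (nth 0 u i <= nth 0 u i.+1).
Proof.
elim: u i => // x u IH [|i] /= hi; last exact: IH.
case: u hi {IH} => // y u _ /=.
case: (leqP x y) => [le_xy|lt_yx]; last first.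
  apply/negbTE; rewrite -ltnNge.
  have -> : count (fun z => z < x) (if y \in u then undup u else y :: undup u)
       = (count (fun z => (z < x) && (z != y)) (undup u)).+1.
    case: ifP => yu /=; last first.
      rewrite lt_yx add1n; congr _.+1; apply: eq_in_count => z.
      by rewrite mem_undup; case: eqVneq => [->|]; rewrite ?yu ?andbT.
    have cy : count_mem y (undup u) = 1.
      by rewrite count_uniq_mem ?undup_uniq ?mem_undup ?yu.
    rewrite -[RHS]addn1 -cy {cy}; elim: (undup u) => //= z s ->.
    by case: (eqVneq z y) => [->|_]; rewrite ?lt_yx; lia.
  by rewrite ltnS; apply: sub_count => z; lia.
have -> : count (fun z => z < x) (if y \in u then undup u else y :: undup u)
       = count (fun z => z < x) (undup u).
  by case: ifP => //= _; rewrite ltnNge le_xy.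
by apply: sub_count => z; lia.
Qed.

Lemma sorted_adjacent u v : size u = size v ->
  (forall i, i.+1 < size u ->
     (nth 0 u i <= nth 0 u i.+1) = (nth 0 v i <= nth 0 v i.+1)) ->
  sorted leq u = sorted leq v.
Proof.
move=> suv h.
by apply/(sortedP 0)/(sortedP 0) => H i hi; [rewrite -h ?suv // H ?suv|
  rewrite h // H -?suv].
Qed.

Fixpoint Jsorted (J u : seq nat) : bool :=
  if J is j :: J' then sorted leq (take j u) && Jsorted J' (drop j u) else true.

Lemma Jsorted_adjacent J u v : size u = size v ->
  (forall i, i.+1 < size u ->
     (nth 0 u i <= nth 0 u i.+1) = (nth 0 v i <= nth 0 v i.+1)) ->
  Jsorted J u = Jsorted J v.
Proof.
elim: J u v => //= j J IH u v suv huv; congr (_ && _).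
  apply: sorted_adjacent => [|i]; rewrite !size_take -?suv // => hi.
  by rewrite !nth_take ?huv //; move: hi; case: ifP; lia.
apply: IH => [|i]; rewrite !size_drop ?suv // => hi.
by rewrite !nth_drop !addnS huv //; lia.
Qed.

Lemma Jsorted_code J u : Jsorted J (code u) = Jsorted J u.
Proof.
by apply: Jsorted_adjacent => [|i]; rewrite size_code // => hi; exact: code_adjacent.
Qed.

(** * From Lehmer codes to codes of packed words *)

(** The element that one step of LC adds, with the ambient interval cut down to the tail length [m];
    [LCsetE] shows that the cut is harmless. *)
Definition newelt (S : seq nat) (m x : nat) : nat :=
  nth 0 [seq z <- iota 1 m | z \notin S] (x - size S).-1.

Fixpoint LCrec (c : seq nat) : seq nat :=
  if c is x :: c' then
    let S := LCrec c' in
    if size S < x then rcons S (newelt S (size c') x) else S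
  else [::].

(** For [D := predT] the sum is [x] itself, by [rank_newelt]; a general [D] keeps only the elements
    of [D] in the rank of the added one. *)
Definition compress1 (D : pred nat) (S : seq nat) (m x : nat) : nat :=
  if size S < x then
    size S + count (fun l => D l && (l \notin S)) (iota 1 (newelt S m x))
  else x.

Fixpoint compress (D : pred nat) (c : seq nat) : seq nat :=
  if c is x :: c' then compress1 D (LCrec c') (size c') x :: compress D c' else [::].

Lemma size_compress D c : size (compress D c) = size c.
Proof. by elim: c => //= x c ->. Qed.

(** Used for the complement of [S] to recover [x] from the added element, and for [D] minus [S] to
    see that compression is bijective. *)
Lemma ranks_filter_iota (P : pred nat) m :
  [seq count P (iota 1 a) | a <- iota 1 m & P a] = iota 1 (count P (iota 1 m)).
Proof.
elim: m => // m IH; rewrite -[m.+1]addn1 iotaD filter_cat map_cat IH count_cat /=.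
rewrite add1n iotaD add1n addn0; case: ifP => Pm //=; congr (_ ++ [:: _]).
by rewrite -[LHS]/(cbound P m.+1) cboundS Pm addn1.
Qed.

Lemma count_mem_iota S m : uniq S -> all (fun s => 0 < s <= m) S ->
  count (mem S) (iota 1 m) = size S.
Proof.
move=> uS /allP hS; rewrite -size_filter; apply/perm_size/uniq_perm => //.
  by rewrite filter_uniq ?iota_uniq.
move=> z; rewrite mem_filter /= andb_idr // => /hS; rewrite mem_iota; lia.
Qed.

(** * One step of the growth of S *)

Section NewElement.
Variables (S : seq nat) (m : nat).
Hypotheses (uS : uniq S) (hS : all (fun s => 0 < s <= m) S).

Lemma size_compl : size [seq z <- iota 1 m | z \notin S] = m - size S.
Proof.
have := count_predC (mem S) (iota 1 m); rewrite count_mem_iota // size_iota.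
by move=> h; rewrite size_filter -[X in X - _]h addKn.
Qed.

Lemma newelt_in x : size S < x <= m ->
  newelt S m x \in [seq z <- iota 1 m | z \notin S].
Proof. by move=> hx; rewrite mem_nth // size_compl; lia. Qed.

Lemma neweltP x : size S < x <= m -> 0 < newelt S m x <= m /\ newelt S m x \notin S.
Proof.
by move/newelt_in; rewrite mem_filter mem_iota => /andP[-> h]; split=> //; lia.
Qed.

Lemma rank_newelt x : size S < x <= m ->
  size S + count (fun l => l \notin S) (iota 1 (newelt S m x)) = x.
Proof.
move=> hx; have hs := size_compl.
have := congr1 (fun s => nth 0 s (x - size S).-1)
  (ranks_filter_iota (fun l => l \notin S) m).
rewrite (nth_map 0) ?hs; last lia.
rewrite -/(newelt _ _ _) => ->; rewrite -size_filter hs nth_iota; lia.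
Qed.

Lemma compress1_predT x : x <= m -> compress1 predT S m x = x.
Proof.
by move=> hx; rewrite /compress1; case: ifP => // h; rewrite rank_newelt //; lia.
Qed.

Variable D : pred nat.
Hypothesis SD : all D S.

Lemma count_DS k : 
  count (fun l => D l && (l \notin S)) (iota 1 k) + count (mem S) (iota 1 k)
  = cbound D k.
Proof.
rewrite /cbound; elim: (iota 1 k) => //= z s <-.
case: (boolP (z \in S)) => zS; last by rewrite andbT; lia.
by rewrite (allP SD _ zS); lia.
Qed.

(** One step of the bijection: the filter keeps the [x] for which [S] stays inside [D]. Values up to
    [size S] are fixed; larger ones go, through the added element, to [size S] plus its rank in [D]
    minus [S]. *)
Lemma map_compress1 :
  [seq compress1 D S m x | x <- iota 0 m.+1 & (x <= size S) || D (newelt S m x)]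
  = iota 0 (cbound D m).+1.
Proof.
have leSm : size S <= m.
  by rewrite -(count_mem_iota uS hS) -[leqRHS](size_iota 1 m) count_size.
have -> : m.+1 = (size S).+1 + (m - size S) by lia.
rewrite iotaD filter_cat map_cat add0n.
rewrite (@eq_in_filter _ _ predT) => [|x]; last by rewrite mem_iota /= => h; apply/orP; left; lia.
rewrite filter_predT (_ : map _ (iota 0 _) = iota 0 (size S).+1); last first.
  rewrite -[RHS]map_id; apply/eq_in_map => x; rewrite mem_iota /compress1.
  by case: ifP => //; lia.
rewrite -(count_DS m) count_mem_iota // addnC.
rewrite -addSn iotaD add0n; congr (_ ++ _).
set P := fun l => _ && _.
rewrite -[(size S).+1]addn1 [RHS]iotaDl -ranks_filter_iota iotaDl.
set A := [seq z <- iota 1 m | z \notin S].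
have -> : [seq a <- iota 1 m | P a] = [seq a <- A | D a].
  by rewrite -filter_predI.
(* The complement of [S] is indexed by its positions: [x = (size S).+1 + i] adds the element of
   index [i]. *)
rewrite -[in RHS](mkseq_nth 0 A) /mkseq size_compl -[1]addn0 iotaDl.
rewrite -map_comp !filter_map -!map_comp.
rewrite (@eq_filter _ _ (fun i => D (nth 0 A i))) => [|i /=]; last first.
  rewrite (_ : _ <= _ = false) /=; last by apply/negbTE; lia.
  by rewrite /newelt (_ : (_ - _).-1 = i) //; lia.
apply: eq_map => i /=; rewrite /compress1 ifT; last lia.
by rewrite /newelt (_ : (_ - _).-1 = i) //; lia.
Qed.

(** Up to the added element [k], the elements of [S] are counted both in [k] and, as [S] lies in
    [D], in [cbound D k]. They cancel and leave the two ranks. *)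
Lemma compress1_weight x : x <= m -> size S < x ->
  compress1 D S m x + newelt S m x = x + cbound D (newelt S m x).
Proof.
move=> xm Sx; have := @rank_newelt x; rewrite /compress1 Sx; set k := newelt _ _ _.
have := count_predC (mem S) (iota 1 k); rewrite size_iota.
have := count_DS k.
have -> : count (predC (mem S)) (iota 1 k) = count (fun l => l \notin S) (iota 1 k) by [].
lia.
Qed.

End NewElement.

Lemma LCrec_ok c : is_code id c ->
  uniq (LCrec c) /\ all (fun s => 0 < s < size c) (LCrec c).
Proof.
elim: c => //= x c IH /andP[xm /IH[uS hS]].
have hS' : all (fun s => 0 < s <= size c) (LCrec c).
  by apply: sub_all hS => s; lia.
case: ifP => Sx; last by split.
have [|h1 h2] := @neweltP _ _ uS hS' x; first lia.
by rewrite rcons_uniq h2 uS all_rcons; split => //; apply/andP; split.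
Qed.

Lemma LCrec_tail x c : is_code id (x :: c) ->
  [/\ x <= size c, uniq (LCrec c) & all (fun s => 0 < s <= size c) (LCrec c)].
Proof.
move=> /andP[xm /LCrec_ok[uS hS]]; split=> //.
by apply: sub_all hS => s; lia.
Qed.

Lemma all_LCrec_cons D x c : all D (LCrec (x :: c)) =
  all D (LCrec c) && ((x <= size (LCrec c)) || D (newelt (LCrec c) (size c) x)).
Proof.
rewrite /=; case: ltnP => h; rewrite ?andbT //.
by rewrite all_rcons andbC.
Qed.

(** Sum of [compress1_weight] over the steps that add an element. The sum of [LCrec c] will become
    the maj term, the sum of the [cbound] the st term. *)
Lemma compress_weight D c : is_code id c -> all D (LCrec c) ->
  sumn (compress D c) + sumn (LCrec c) = sumn c + \sum_(s <- LCrec c) cbound D s.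
Proof.
elim: c => [|x c IH hxc]; first by rewrite /= big_nil.
have [xm uS hS] := LCrec_tail hxc; case/andP: hxc => _ /IH{}IH.
rewrite all_LCrec_cons => /andP[SD hx]; move: IH => /(_ SD).
rewrite /=; case: ltnP => h; last by rewrite /compress1 ltnNge h /=; lia.
by have := compress1_weight uS hS SD xm h; rewrite sumn_rcons big_rcons /=; lia.
Qed.

(** * Compression preserves adjacent comparisons *)

Lemma count_iota_lt (P : pred nat) a b : a < b -> P b ->
  count P (iota 1 a) < count P (iota 1 b).
Proof.
case: b => // b ab Pb; rewrite -/(cbound P b.+1) cboundS Pb addn1 ltnS.
by rewrite -(subnKC (_ : a <= b)) // /cbound iotaD count_cat leq_addr.
Qed.

Lemma count_notin_rcons (D : pred nat) (S : seq nat) s r : D s -> s \notin S ->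
  count (fun l => D l && (l \notin rcons S s)) r + count_mem s r =
  count (fun l => D l && (l \notin S)) r.
Proof.
move=> Ds sS; elim: r => //= z r <-; rewrite mem_rcons inE negb_or.
by case: (eqVneq z s) => [->|_]; rewrite ?Ds ?sS /=; lia.
Qed.

(* The right-hand side does not involve [D], and [compress1 predT] is the identity
   on codes: hence compression preserves the comparison of consecutive entries. *)
Lemma compress1_adjacent (D : pred nat) (S : seq nat) m x x' :
  uniq S -> all (fun s => 0 < s <= m) S ->
  let S' := if size S < x then rcons S (newelt S m x) else S in
  all D S' -> x <= m -> x' <= m.+1 ->
  (x' <= size S') || D (newelt S' m.+1 x') ->
  (compress1 D S' m.+1 x' <= compress1 D S m x) =
  if size S < x then (x' <= (size S).+1) || (newelt S' m.+1 x' < newelt S m x)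
  else x' <= x.
Proof.
move=> uS hS S'; have S'D : S' = if size S < x then rcons S (newelt S m x) else S by [].
move: S' S'D => S' S'D SD' xm xm' hx'.
have uS' : uniq S' /\ all (fun s => 0 < s <= m.+1) S'.
  rewrite S'D; case: ifP => h; last by split => //; apply: sub_all hS => s; lia.
    have [|h1 h2] := @neweltP _ _ uS hS x; first lia.
  rewrite rcons_uniq h2 uS all_rcons; split => //; apply/andP; split; first lia.
  by apply: sub_all hS => s; lia.
case: uS' => uS' hS'.
case: ltnP => Sx; last first.
  have S'E : S' = S by rewrite S'D ltnNge Sx.
  rewrite {2}/compress1 ltnNge Sx /= {1}/compress1; case: ltnP => // Sx'; apply/idP/idP; last first.
    by rewrite S'E in Sx' *; lia.
  have [|h1 h2] := @neweltP _ _ uS' hS' x'; first lia.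
  move: hx'; rewrite leqNgt Sx' /= => Dx'.
  (* The added element is itself counted, so the compressed value exceeds [size S], hence [x]. *)
  have := @count_iota_lt (fun l => D l && (l \notin S')) 0 _ (proj1 (andP h1)).
  by rewrite Dx' h2 => /(_ isT) /=; move/(congr1 size): S'E; lia.
have S'E : S' = rcons S (newelt S m x) by rewrite S'D Sx.
have sS' : size S' = (size S).+1 by rewrite S'E size_rcons.
have [|h1 h2] := @neweltP _ _ uS hS x; first lia.
have Dx : D (newelt S m x) by move: SD'; rewrite S'E all_rcons => /andP[].
rewrite {2}/compress1 Sx {1}/compress1 sS'; set s := newelt S m x in S'E h1 h2 Dx *.
pose P l := D l && (l \notin S).
rewrite -/P.
have Ps : P s by rewrite /P Dx.
case: ltnP => Sx' /=; last first.
  by have := @count_iota_lt P 0 s; rewrite Ps /=; lia.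
have [|h1' h2'] := @neweltP _ _ uS' hS' x'; first lia.
move: hx'; rewrite leqNgt sS' Sx' /= => Dx'.
set s' := newelt S' m.+1 x' in h1' h2' Dx' *.
have /andP[ss' s'S] : (s' != s) && (s' \notin S).
  by move: h2'; rewrite S'E mem_rcons inE negb_or.
have Ps' : P s' by rewrite /P Dx'.
(* [S'] has only [s] more than [S], so the two counts up to [s'] differ by one exactly when
   [s <= s']. *)
have cE : count (fun l => D l && (l \notin S')) (iota 1 s') + (s <= s') =
    count P (iota 1 s').
  rewrite S'E -(count_notin_rcons _ Dx h2) count_uniq_mem ?iota_uniq // mem_iota.
  by case/andP: h1 => -> _; rewrite add1n ltnS.
move: cE; case: (ltnP s' s) => lt cE.
  by have := count_iota_lt lt Ps; rewrite -cE addn0 addSnnS leq_add2l.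
have lt' : s < s' by rewrite ltn_neqAle eq_sym ss'.
have := count_iota_lt lt' Ps'; rewrite -cE addn1 ltnS => le.
by apply/negbTE; rewrite -ltnNge addSn ltnS leq_add2l.
Qed.

Lemma compress_adjacent D c i : is_code id c -> all D (LCrec c) -> i.+1 < size c ->
  (nth 0 (compress D c) i <= nth 0 (compress D c) i.+1) = (nth 0 c i <= nth 0 c i.+1).
Proof.
elim: c i => // x' c IH i hxc; rewrite all_LCrec_cons => /andP[SD hx'].
case: i => [|i] hi; last by rewrite /=; apply: IH => //; case/andP: hxc.
case: c hi hxc SD hx' {IH} => // x c _ hxc SD hx'.
have [xm' _ _] := LCrec_tail hxc; case/andP: (hxc) => _ /LCrec_tail[xm uS hS].
have [_ uS' hS'] := LCrec_tail hxc.
rewrite [LHS](@compress1_adjacent D (LCrec c) (size c) x x') //.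
rewrite -(@compress1_adjacent predT (LCrec c) (size c) x x') ?all_predT ?orbT //.
by rewrite !compress1_predT.
Qed.

Lemma Jsorted_compress J D c : is_code id c -> all D (LCrec c) ->
  Jsorted J (compress D c) = Jsorted J c.
Proof.
move=> hc hD; apply: Jsorted_adjacent => [|i]; rewrite size_compress // => hi.
exact: compress_adjacent.
Qed.

(** * Sums over codes *)

Lemma codesS b m :
  codes b m.+1 = [seq x :: c | c <- codes b m, x <- iota 0 (b m).+1].
Proof. by []. Qed.

Lemma mem_codes b m d : (d \in codes b m) = (size d == m) && is_code b d.
Proof.
elim: m d => [|m IH] d; first by rewrite inE; case: d.
apply/allpairsP/idP => [[[c x] /= [hc hx ->]]|].
  move: hc hx; rewrite IH -/(iota 0 (b m).+1) mem_iota add0n ltnS.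
  by case/andP=> /eqP sc hc hx; rewrite /= sc eqxx (andP hx).2.
case: d => //= y d /andP[/eqP[sd] /andP[hy hd]]; exists (d, y); split=> //.
  by rewrite IH sd eqxx.
by rewrite -[_ \in _]/(y \in iota 0 (b m).+1) mem_iota -sd add0n ltnS.
Qed.

Lemma codes_uniq b m : uniq (codes b m).
Proof.
elim: m => // m IH; apply: (@allpairs_uniq _ _ _ (fun c x => x :: c)); rewrite ?iota_uniq //.
by move=> [c x] [c' x'] /= _ _ [-> ->].
Qed.

Lemma size_codes_id m : size (codes id m) = m`!.
Proof. by elim: m => // m IH; rewrite codesS size_allpairs size_iota IH factS mulnC. Qed.

(** Change of variables along [compress]: for a fixed tail, [map_compress1] carries the admissible
    heads onto the heads allowed by [cbound D]. *)
Lemma big_compress (R : Type) (idx : R) (op : Monoid.com_law idx) (D : pred nat) m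
  (G : seq nat -> R) :
  \big[op/idx]_(c <- codes id m | all D (LCrec c)) G (compress D c) =
  \big[op/idx]_(d <- codes (cbound D) m) G d.
Proof.
elim: m G => [|m IH] G; first by rewrite big_cons big_nil big_seq1 /= Monoid.mulm1.
rewrite big_mkcond !codesS !big_allpairs_dep.
(* The sum over heads on the target side depends only on the compressed tail, so it can serve as [G]
   in the induction hypothesis. *)
rewrite -(IH (fun d => \big[op/idx]_(x <- iota 0 (cbound D m).+1) G (x :: d))).
rewrite [RHS]big_mkcond.
apply: eq_big_seq => c; rewrite mem_codes => /andP[/eqP sc hc].
have [uS /allP hS] := LCrec_ok hc.
under eq_bigr do rewrite all_LCrec_cons.
case: ifP => SD; last by rewrite big1.
rewrite -(@map_compress1 (LCrec c)) //; last first.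
  by apply/allP => s /hS; rewrite sc; lia.
rewrite big_map big_filter [RHS]big_mkcond /=; apply: eq_bigr => x _.
by rewrite sc.
Qed.

(** * Compositions and descent sets *)

Local Arguments des : simpl never.

Lemma scanl_addn x J : scanl addn x J = [seq x + d | d <- scanl addn 0 J].
Proof.
elim: J x => //= j J IH x; rewrite (IH (x + j)) (IH (0 + j)) -map_comp add0n.
by congr cons; apply: eq_map => d /=; rewrite addnA.
Qed.

Lemma des_cons j J :
  des (j :: J) = if J is _ :: _ then j :: [seq j + d | d <- des J] else [::].
Proof.
by case: J => [|j' J] //; rewrite /des map_take -scanl_addn.
Qed.

Lemma size_des J : size (des J) = (size J).-1.
Proof. by rewrite /des size_take size_scanl; case: ifP => //; lia. Qed.

Lemma foldl_addn s : foldl addn 0 s = sumn s.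
Proof. by elim/last_ind: s => // s x IH; rewrite foldl_rcons sumn_rcons IH. Qed.

Lemma nth_scanl_addn J k : k < size J ->
  nth 0 (scanl addn 0 J) k = sumn (take k.+1 J).
Proof. by move=> h; rewrite nth_scanl // foldl_addn. Qed.

Lemma nth_des J k : k < (size J).-1 -> nth 0 (des J) k = sumn (take k.+1 J).
Proof. by move=> h; rewrite nth_take // nth_scanl_addn //; lia. Qed.

Lemma rcons_des J : J != [::] -> rcons (des J) (sumn J) = scanl addn 0 J.
Proof.
case: J => // j J _; rewrite -[RHS]take_size size_scanl (take_nth 0) ?size_scanl //.
by rewrite nth_scanl_addn // (@take_oversize _ _ (j :: J)).
Qed.

Lemma des_bound n J : is_comp n J -> all (fun d => 0 < d < n) (des J).
Proof.
elim: J n => // j J IH n /andP[/= /andP[j0 J0] /eqP sn]; rewrite des_cons.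
case: J IH J0 sn => // j' J IH J0 sn; rewrite /= all_map; apply/andP; split.
  by case/andP: J0 sn => /=; lia.
apply: sub_all (IH (n - j) _) => [d /=|]; first lia.
by rewrite /is_comp J0 -sn addKn eqxx.
Qed.

Lemma des_sorted n J : is_comp n J -> sorted ltn (des J).
Proof.
elim: J n => // j J IH n /andP[/= /andP[j0 J0] /eqP sn]; rewrite des_cons.
case: J IH J0 sn => // j' J IH J0 sn.
have hJ : is_comp (n - j) (j' :: J) by rewrite /is_comp J0 -sn addKn eqxx.
rewrite /= path_sortedE; last exact: ltn_trans.
rewrite all_map; apply/andP; split.
  by apply: sub_all (des_bound hJ) => d /=; lia.
by rewrite sorted_map; apply: sub_sorted (IH _ hJ) => x y /=; rewrite ltn_add2l.
Qed.

Lemma comp_of_desK n J : is_comp n J -> comp_of_des n (des J) = J.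
Proof.
move=> hJ; have sJ := des_sorted hJ; case/andP: (hJ) => J0 /eqP sn.
move: sJ; rewrite ltn_sorted_uniq_leq => /andP[uJ sJ].
case: n hJ sn => [|n] hJ sn.
  by case: (J) J0 sn => // j J' /= /andP[]; lia.
rewrite /comp_of_des undup_id // sorted_sort //; last exact: leq_trans.
by rewrite -sn rcons_des ?(scanlK addKn) //; apply: contra_eq_neq sn => ->.
Qed.

Lemma scanl_pairmap_subn x s : path leq x s ->
  scanl addn x (pairmap (fun a b => b - a) x s) = s.
Proof. by elim: s x => //= y s IH x /andP[xy /IH]; rewrite subnKC // => ->. Qed.

(** Partial sums undo successive differences, because 0, the sorted elements of [F] and [n] increase
    strictly; strictness also makes the parts positive. *)
Lemma des_comp_of_des n F : all (fun f => 0 < f < n) F ->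
  des (comp_of_des n F) = sort leq (undup F) /\ is_comp n (comp_of_des n F).
Proof.
case: n => [|n]; first by case: F => //= f F /andP[]; lia.
move=> hF; set G := sort leq (undup F).
have uG : uniq G by rewrite sort_uniq undup_uniq.
have hG : all (fun f => 0 < f < n.+1) G.
  by rewrite all_sort; apply/allP => f; rewrite mem_undup => /(allP hF).
have sG : sorted ltn (rcons (0 :: G) n.+1).
  rewrite rcons_cons /= rcons_path; apply/andP; split; last first.
    by have := mem_last 0 G; rewrite inE => /orP[/eqP->//|/(allP hG) /andP[]].
  rewrite path_sortedE; last exact: ltn_trans.
  rewrite ltn_sorted_uniq_leq uG sort_sorted ?andbT; last exact: leq_total.
  by apply: sub_all hG => f /andP[].
have pG : path leq 0 (rcons G n.+1).
  by apply: sub_path sG => x y; exact: ltnW.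
have sc : scanl addn 0 (comp_of_des n.+1 F) = rcons G n.+1.
  exact: scanl_pairmap_subn.
have zE : size (comp_of_des n.+1 F) = (size G).+1.
  by rewrite size_pairmap size_rcons.
split; first by rewrite /des sc zE /= -cats1 take_size_cat.
have nE : comp_of_des n.+1 F != [::] by rewrite -size_eq0 zE.
rewrite /is_comp; apply/andP; split; last first.
  by have /eqP := rcons_des nE; rewrite sc eqseq_rcons => /andP[].
apply/(all_nthP 0) => i; rewrite zE => hi.
rewrite (nth_pairmap 0) ?size_rcons // subn_gt0.
by have /(sortedP 0) /(_ i) := sG; rewrite rcons_cons /= size_rcons => /(_ hi).
Qed.

Lemma comp_of_des_eq n F H : is_comp n H -> all (fun f => 0 < f < n) F ->
  (comp_of_des n F = H) <-> (F =i des H).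
Proof.
move=> hH hF; have [dE _] := des_comp_of_des hF; split=> [<- x|h].
  by rewrite dE mem_sort mem_undup.
rewrite -[RHS](comp_of_desK hH) /comp_of_des; case: (n) => // n'.
congr (pairmap _ _ (rcons _ _)); apply/perm_sortP.
- exact: leq_total.
- exact: leq_trans.
- exact: anti_leq.
by apply: uniq_perm; rewrite ?undup_uniq // => x; rewrite !mem_undup.
Qed.

(** The t-th of r parts occurs in the r - t descents that are partial sums from t on. *)
Lemma majE J : maj J = sumn (des J).
Proof.
elim: J => [|j J IH]; first by rewrite /maj big_ord0.
rewrite /maj big_ord_recl /= des_cons subn1 /=.
under eq_bigr => i _ do rewrite /bump leq0n add1n subSS.
rewrite -/(maj J) IH; case: J {IH} => [|j' J] //=.
rewrite mulSn -addnA; congr (_ + _).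
have -> : size J = size (des (j' :: J)) by rewrite size_des.
elim: (des _) => //= d s <-; lia.
Qed.

Lemma des_rev n J : is_comp n J -> des (rev J) = rev [seq n - d | d <- des J].
Proof.
case/andP=> _ /eqP <-; apply: (@eq_from_nth _ 0).
  by rewrite size_rev size_map !size_des size_rev.
move=> k; rewrite size_des size_rev => hk.
rewrite nth_des ?size_rev // nth_rev ?size_map ?size_des //.
rewrite (nth_map 0) ?size_des; last lia.
rewrite nth_des; last lia.
rewrite take_rev sumn_rev (_ : (_ - k.+1).+1 = size J - k.+1); last lia.
have -> : sumn J = sumn (take (size J - k.+1) J) + sumn (drop (size J - k.+1) J).
  by rewrite -sumn_cat cat_take_drop.
by rewrite addKn.
Qed.

(** Summing over the descents of [J] first allows a comparison with a sum over the elements of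
    [S]. *)
Lemma st_sum I J : st I J = \sum_(b <- des J) count (fun a => b <= a) (des I).
Proof.
rewrite /st; under eq_bigr do rewrite -sum1_count big_mkcond.
rewrite exchange_big; apply: eq_bigr => b _.
by rewrite -sum1_count [RHS]big_mkcond.
Qed.

(** Parts are positive, so fuel [n] already suffices. *)
Lemma compsF_mem m n I : n <= m -> is_comp n I -> I \in compsF m n.
Proof.
elim: m n I => [|m IH] n I; case: n => [|n] // nm /andP[I0 /eqP sI] /=.
- by case: I I0 sI => // i I /andP[] /=; lia.
- by case: I I0 sI => // i I /andP[] /=; lia.
case: I I0 sI => // i I /= /andP[i0 I0] sI.
apply/(@allpairsPdep _ _ _ (fun k c => k :: c) (iota 1 n.+1) (fun k => compsF m (n.+1 - k))).
exists i, I; split => //; first by rewrite mem_iota; lia.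
by apply: IH; [lia|rewrite /is_comp I0; apply/eqP; lia].
Qed.

Lemma compsF_uniq m n : uniq (compsF m n).
Proof.
elim: m n => [|m IH] [|n] //.
apply: (@allpairs_uniq_dep _ _ _ (fun k c => k :: c) (iota 1 n.+1) (fun k => compsF m (n.+1 - k))).
- exact: iota_uniq.
- by move=> k _; exact: IH.
by move=> [a b] [a' b'] _ _ /= [-> ->].
Qed.

(** * Packed words *)

Lemma packedP w : reflect (exists k, w =i iota 1 k) (packed w).
Proof.
apply: (iffP andP) => [[w0 /allP hw]|[k hk]].
  exists (\max_(x <- w) x) => x; apply/idP/idP => [xw|/hw //].
  have x0 : x != 0 by apply: contraNneq w0 => <-.
  have := @leq_bigmax_seq _ w xpredT id x xw isT.
  by rewrite mem_iota; lia.
split; first by rewrite hk mem_iota.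
apply/allP => x; rewrite hk !mem_iota => /andP[-> hx] /=; apply: leq_trans hx _.
rewrite !add1n ltnS; apply/bigmax_leqP_seq => y; rewrite hk mem_iota; lia.
Qed.

Lemma size_pack w : size (pack w) = size w.
Proof. exact: size_map. Qed.

Lemma packed_pack w : packed (pack w).
Proof.
apply/packedP; exists (size (undup w)) => x; rewrite mem_iota.
apply/mapP/idP => [[y yw ->]|hx].
  rewrite /= add1n ltnS -(size_sort leq) index_mem mem_sort mem_undup //.
exists (nth 0 (sort leq (undup w)) x.-1).
  by rewrite -mem_undup -(mem_sort leq) mem_nth // size_sort; lia.
by rewrite index_uniq ?sort_uniq ?undup_uniq ?size_sort; lia.
Qed.

Lemma nth_pack w i : i < size w ->
  nth 0 (pack w) i = (index (nth 0 w i) (sort leq (undup w))).+1.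
Proof. by move=> hi; rewrite (nth_map 0). Qed.

Lemma pack_adjacent w i : i.+1 < size w ->
  (nth 0 (pack w) i <= nth 0 (pack w) i.+1) = (nth 0 w i <= nth 0 w i.+1).
Proof.
move=> hi; rewrite !nth_pack ?(ltnW hi) // ltnS.
have hm k : k < size w -> nth 0 w k \in sort leq (undup w).
  by move=> hk; rewrite mem_sort mem_undup mem_nth.
have sL : sorted leq (sort leq (undup w)) by apply: sort_sorted; exact: leq_total.
have sT : sorted ltn (sort leq (undup w)).
  by rewrite ltn_sorted_uniq_leq sL sort_uniq undup_uniq.
apply/idP/idP.
  by apply: (sorted_leq_index leq_trans leqnn sL); rewrite hm // ltnW.
apply: contraTT; rewrite -!ltnNge.
by apply: (sorted_ltn_index ltn_trans sT); rewrite hm // ltnW.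
Qed.

Lemma sorted_pack w : sorted leq (pack w) = sorted leq w.
Proof.
apply: sorted_adjacent; rewrite size_pack // => i hi; exact: pack_adjacent.
Qed.

Lemma Jsorted_pack J w : Jsorted J (pack w) = Jsorted J w.
Proof.
apply: Jsorted_adjacent; rewrite size_pack // => i hi; exact: pack_adjacent.
Qed.

Lemma sinv_sorted w : sorted leq w -> sinv w = 0.
Proof.
rewrite sinvE; elim: w => //= x w IH pw; rewrite IH ?(path_sorted pw) // addn0.
apply/eqP; rewrite eqn0Ngt -has_count; apply/hasPn => y; rewrite mem_undup => yw.
by rewrite -leqNgt; apply: (allP (order_path_min leq_trans pw)).
Qed.

(** * Coefficients of S^J on packed words *)

Section WordSums.
Variable K : fieldType.
Local Open Scope ring_scope.

Lemma q_neq0 : q K != 0.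
Proof. by rewrite tofrac_eq0 polyX_eq0. Qed.

(** A nondecreasing first block has [sinv] 0, so the twist of each product replaces the weight of
    the tail by that of the whole word. *)
Lemma SprodE J u : packed u -> size u = sumn J ->
  Sprod K J u = if Jsorted J u then q K ^+ sinv u else 0.
Proof.
elim: J u => [|j J IH] u pu su /=.
  by case: u su {pu} => // _; rewrite /WQone eqxx /sinv big_ord0 expr0.
rewrite /qstar pu IH ?packed_pack //; last by rewrite size_pack size_drop su /= addKn.
rewrite /Stilde packed_pack sorted_pack size_pack size_takel; last first.
  by rewrite su /= leq_addr.
rewrite eqxx andbT /= Jsorted_pack.
case: (boolP (sorted leq _)) => st /=; last by rewrite mulr0 mul0r.
case: ifP => _; last by rewrite mulr0.
rewrite mulr1 (@sinv_sorted (pack (take j u))) ?sorted_pack // subr0.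
by rewrite [X in _ * X]exprnP -expfzDr ?q_neq0 // subrK.
Qed.

End WordSums.

Lemma lastpatP D u : reflect
  (forall p, 0 < p < size u -> (nth 0 u p.-1 \notin drop p u) = D (size u - p))
  (lastpat D u).
Proof.
elim: u => [|x u IH] /=; first by apply: ReflectT => p; lia.
apply: (iffP andP) => [[hx /IH hu] [|[|p]] // hp|h].
- rewrite /= drop0 subn1 /=; case/orP: hx => [/eqP u0|/eqP //].
  by move: hp; rewrite u0.
- by rewrite /= -hu //; lia.
split; last first.
  by apply/IH => p hp; rewrite -[in RHS]subSS -h; case: p hp => //= p; lia.
case: (eqVneq u [::]) => //= un; have := h 1.
by rewrite /= drop0 subn1 /= => -> //; case: (u) un.
Qed.

(** A position [p] from the left is followed by [n - p] letters, which turns the descent set into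
    the predicate required by [lastpat]. *)
Lemma WC_lastpat n H u : is_comp n H -> size u = n ->
  (WC u == H) = lastpat (fun m => n - m \in des H) u.
Proof.
move=> hH su; rewrite /WC su; set F := filter _ _.
have hF : all (fun f => 0 < f < n) F.
  by apply/allP => f; rewrite mem_filter mem_iota; lia.
have := comp_of_des_eq hH hF => hE.
apply/eqP/lastpatP => [/hE h p|h].
  rewrite su => hp; rewrite subKn; last lia.
  rewrite -h mem_filter mem_iota (_ : _ <= _ < _ = true) ?andbT //; lia.
apply/hE => p; rewrite mem_filter mem_iota.
case: (boolP (0 < p < n)) => hp.
  rewrite h ?su // subKn; last lia.
  by rewrite (_ : _ <= _ < _ = true) ?andbT //; lia.
rewrite (_ : _ <= _ < _ = false) ?andbF; last lia.
by apply/esym/negP => /(allP (des_bound hH)); rewrite (negPf hp).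
Qed.

Lemma word_of_inj n : injective (@word_of n).
Proof.
move=> t t' /(inj_map (f := fun i : 'I_n => (val i).+1)) h.
by apply/val_inj/h => i j [] /val_inj.
Qed.

Lemma word_ofP n w : size w = n -> packed w -> exists t : n.-tuple 'I_n, word_of t = w.
Proof.
move=> sw /packedP[k hk].
have kn : k <= n.
  rewrite -(size_iota 1 k) -sw; apply: uniq_leq_size; first exact: iota_uniq.
  by move=> x; rewrite hk.
(* [inord] needs a nonempty ordinal type, so length 0 is treated apart. *)
case: n sw kn => [|n] sw kn; first by exists [tuple]; case: w sw {hk}.
have st : size [seq (inord x.-1 : 'I_n.+1) | x <- w] == n.+1 by rewrite size_map sw.
exists (Tuple st); rewrite /word_of /= -map_comp -[RHS]map_id.
apply/eq_in_map => x; rewrite hk mem_iota /= => hx.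
by rewrite inordK; lia.
Qed.

(** [code] and [decode D] are inverse bijections between the packed words with [WC] equal to [H] and
    the codes bounded by [cbound D]. *)
Lemma zetaE (K : fieldType) n H (f : WQ K) : is_comp n H ->
  let D := (fun m => n - m \in des H) in
  zeta n f H = (\sum_(d <- codes (cbound D) n) f (decode D d))%R.
Proof.
move=> hH D; have D0 : D 0 = false.
  by apply/negP; rewrite /D subn0 => /(allP (des_bound hH)); lia.
rewrite /zeta -big_filter -(big_map (@word_of n) xpredT f) -(big_map (decode D) xpredT f).
apply/perm_big/uniq_perm.
- by rewrite (map_inj_uniq (@word_of_inj n)) filter_uniq ?index_enum_uniq.
- rewrite map_inj_in_uniq ?codes_uniq // => d d'; rewrite !mem_codes.
  by move=> /andP[_ hd] /andP[_ hd'] /(congr1 code); rewrite !code_decode.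
move=> w; apply/mapP/mapP => [[t + ->]|[d + ->]].
  rewrite mem_filter => /andP[/andP[/packedP[k hk]]].
  have st : size (word_of t) = n by rewrite size_map size_tuple.
  rewrite (WC_lastpat hH st) => pw _.
  have [hc de] := decode_code D0 pw hk.
  by exists (code (word_of t)); rewrite // mem_codes size_code st eqxx.
rewrite mem_codes => /andP[/eqP sd hd].
have pd : packed (decode D d) by apply/packedP; exists (nletters D (size d)); exact: decode_mem.
have sw : size (decode D d) = n by rewrite size_decode.
have [t tE] := word_ofP sw pd; exists t => //.
by rewrite mem_filter mem_index_enum tE pd (WC_lastpat hH sw) lastpat_decode.
Qed.

(** * Permutations *)

Section Perm.
Variable n : nat.
Implicit Type s : 'S_n.

(** The word of the inverse permutation: letters of [s] become positions, so recoils become descents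
    and the numbers c_t become code entries. *)
Definition iword s : seq nat := [seq (val ((s^-1)%g i)).+1 | i <- enum 'I_n].

Lemma size_iword s : size (iword s) = n.
Proof. by rewrite size_map size_enum_ord. Qed.

Lemma nth_iword s (i : 'I_n) : nth 0 (iword s) i = (val ((s^-1)%g i)).+1.
Proof. by rewrite (nth_map i) ?size_enum_ord // nth_ord_enum. Qed.

Lemma iword_uniq s : uniq (iword s).
Proof.
by rewrite map_inj_uniq ?enum_uniq // => i j [] /val_inj /perm_inj.
Qed.

Lemma iword_mem s : iword s =i iota 1 n.
Proof.
apply: (uniq_min_size (iword_uniq s) _ _).2; last by rewrite size_iota size_iword.
by move=> x /mapP[i _ ->]; rewrite mem_iota /= add1n ltnS.
Qed.

Lemma iword_inj : injective iword.
Proof.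
move=> s s' h; apply: invg_inj; apply/permP => i; apply/val_inj.
by have := congr1 (fun u => nth 0 u i) h; rewrite !nth_iword => -[].
Qed.

Lemma lastpat_uniq (D : pred nat) u : uniq u -> (forall m, 0 < m -> D m) -> lastpat D u.
Proof.
move=> + hD; elim: u => //= x u IH /andP[xu /IH ->]; rewrite xu andbT.
by case: u {xu IH} => //= y u; rewrite hD.
Qed.

Lemma cbound_gt0 m : cbound (leq 1) m = m.
Proof. by elim: m => // m IH; rewrite cboundS IH addn1. Qed.

Lemma eq_is_code b b' d : b =1 b' -> is_code b d = is_code b' d.
Proof. by move=> hb; elim: d => //= y d ->; rewrite hb. Qed.

Definition lehmer s : seq nat := code (iword s).

Lemma size_lehmer s : size (lehmer s) = n.
Proof. by rewrite size_code size_iword. Qed.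

(* The word of a permutation is a packed word all of whose positions are last
   occurrences, so the results on packed words apply with [D] everything but 0. *)
Lemma lehmer_is_code s : is_code id (lehmer s) /\ decode (leq 1) (lehmer s) = iword s.
Proof.
rewrite -(eq_is_code _ cbound_gt0); apply: (@decode_code (leq 1) (erefl false) _ n).
  by apply: lastpat_uniq; first exact: iword_uniq.
exact: iword_mem.
Qed.

(** Decoding gives injectivity; both sides have n! elements. *)
Lemma lehmer_perm_eq : perm_eq [seq lehmer s | s <- index_enum {perm 'I_n}] (codes id n).
Proof.
have u1 : uniq [seq lehmer s | s <- index_enum {perm 'I_n}].
  rewrite map_inj_uniq ?index_enum_uniq // => s s' h; apply: iword_inj.
  by rewrite -(lehmer_is_code s).2 -(lehmer_is_code s').2 h.
apply: uniq_perm => //; first exact: codes_uniq.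
apply: (uniq_min_size u1 _ _).2.
  move=> c /mapP[s _ ->]; rewrite mem_codes size_lehmer eqxx.
  exact: (lehmer_is_code s).1.
by rewrite size_codes_id size_map -card_Sn cardE enumT.
Qed.

Lemma undup_drop s k : undup (drop k (iword s)) = drop k (iword s).
Proof. by rewrite undup_id // drop_uniq // iword_uniq. Qed.

Lemma count_drop (a : pred nat) k u :
  count a (drop k u) = \sum_(j < size u) ((k <= j) && a (nth 0 u j) : nat).
Proof.
elim: u k => [|x u IH] [|k]; rewrite ?big_ord0 //= big_ord_recl /=.
  by have := IH 0; rewrite drop0 => ->; congr (_ + _); apply: eq_bigr.
by rewrite IH add0n.
Qed.

(** A larger letter standing to the left of [i] in [s] is a smaller value to the right of position
    [i] in the inverse. *)
Lemma cLCE s (i : 'I_n) : cLC s i.+1 = nth 0 (lehmer s) i.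
Proof.
rewrite nth_code ?size_iword // undup_drop count_drop size_iword /cLC -sum1_card.
rewrite big_mkcond (reindex_inj (@perm_inj _ s^-1%g)) /=; apply: eq_bigr => j _.
rewrite inE nth_iword nth_iword permKV ltnS.
have -> : [exists p' : 'I_n, (s p' == i :> nat) && ((s^-1)%g j < p') && (i < j)]
  = (i < j) && ((s^-1)%g j < (s^-1)%g i).
  apply/existsP/andP => [[p /andP[/andP[/eqP/val_inj <-]]]|[ij h]].
    by rewrite permK.
  by exists (s^-1 i)%g; rewrite permKV eqxx h.
by case: (_ && _).
Qed.

Lemma inv_permE s : inv_perm s = sumn (lehmer s).
Proof.
rewrite -sinvE /inv_perm /sinv size_iword exchange_big -sum1_card pair_big /=.
rewrite big_mkcond /=.
(* An inversion of the inverse at positions [a < b] is the inversion of [s] at positions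
   [s^-1 b < s^-1 a]. *)
rewrite (reindex_inj (h := fun p : 'I_n * 'I_n => ((s^-1)%g p.2, (s^-1)%g p.1))) /=; last first.
  by move=> [a b] [a' b'] /= [] /perm_inj -> /perm_inj ->.
apply: eq_bigr => -[a b] _; rewrite inE /= !permKV !nth_iword ltnS.
have -> : (val ((s^-1)%g b)).+1 \notin drop b.+1 (iword s).
  have : uniq (take b.+1 (iword s) ++ drop b.+1 (iword s)).
    by rewrite cat_take_drop iword_uniq.
  rewrite cat_uniq; case/and3P=> _ /hasPn /(_ (val ((s^-1)%g b)).+1) h _.
  apply/negP => hin; have /negP := h hin; apply.
  rewrite (take_nth 0) ?size_iword // mem_rcons nth_iword mem_head //.
by rewrite andbT andbC; case: (_ && _).
Qed.

Lemma filter_iota_prefix (a : pred nat) m k i : m <= k ->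
  i < size [seq z <- iota 1 m | a z] ->
  nth 0 [seq z <- iota 1 k | a z] i = nth 0 [seq z <- iota 1 m | a z] i.
Proof. by move=> mk hi; rewrite -(subnKC mk) iotaD filter_cat nth_cat hi. Qed.

(** The loop over t = n, ..., 1 reads the Lehmer code from right to left. *)
Lemma LCsetE s : LCset s = LCrec (lehmer s).
Proof.
rewrite /LCset foldl_rev.
suff h m k : k + m = n ->
    foldr (fun t S => LCstep s t S) [::] (iota k.+1 m) = LCrec (drop k (lehmer s)).
  by have := h n 0 (add0n n); rewrite drop0.
elim: m k => [|m IH] k km; first by rewrite drop_oversize // size_lehmer; lia.
have hk : k < n by lia.
have : is_code id (drop k (lehmer s)).
  have := (lehmer_is_code s).1; elim: (lehmer s) k {hk km} => [|x c IHc] [|k] //=.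
  by case/andP=> _ /IHc.
rewrite [iota _ _]/= [foldr _ _ _]/= IH; last lia.
rewrite (drop_nth 0) ?size_lehmer // => /LCrec_tail[xm uS hS].
rewrite /LCstep (cLCE s (Ordinal hk)) /=; case: ifP => // Sx; congr rcons.
have sz : size (drop k.+1 (lehmer s)) = m by rewrite size_drop size_lehmer; lia.
(* Since c_t is at most the tail length, the selected element already lies in the shorter
   interval. *)
rewrite /newelt (@filter_iota_prefix _ (size (drop k.+1 (lehmer s)))) //; first lia.
by rewrite size_compl //; lia.
Qed.

(** [LC] is a reversal: undoing it leaves the descent set [S], whose sum is maj, while performing it
    reflects [S] by [n - x]. *)
Lemma LC_spec s : let S := LCrec (lehmer s) in
  [/\ is_comp n (LC s), maj (crev (LC s)) = sumn S &
      perm_eq (des (LC s)) [seq n - x | x <- S]].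
Proof.
move=> S; have [uS hS] := LCrec_ok (lehmer_is_code s).1.
rewrite size_lehmer in hS.
rewrite /LC LCsetE -/S; have [dE cC] := des_comp_of_des hS.
have pS : perm_eq (des (comp_of_des n S)) S.
  by rewrite dE perm_sort undup_id.
split.
- by move: cC; rewrite /is_comp /crev all_rev sumn_rev.
- by rewrite /crev revK majE; exact: perm_sumn.
- by rewrite /crev (des_rev cC) perm_rev; exact: perm_map.
Qed.

(** A descent is allowed only between two blocks. With indices from 0, the letter [i] starts a block
    when [i] is the total length of the blocks before it. *)
Lemma Jsorted_des J u m : is_comp m J -> size u = m ->
  reflect (forall i, 0 < i < m -> nth 0 u i < nth 0 u i.-1 -> i \in des J)
          (Jsorted J u).
Proof.
elim: J u m => [|j J IH] u m.
  by case/andP=> _ /eqP /= <- _; apply: ReflectT => i; lia.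
move=> hJ su; case/andP: (hJ) => /= /andP[j0 J0] /eqP sm.
have hJ' : is_comp (sumn J) J by rewrite /is_comp J0 eqxx.
have sd : size (drop j u) = sumn J by rewrite size_drop su -sm addKn.
apply: (iffP andP) => [[h1 /(IH _ _ hJ' sd) h2] i hi lt|h].
  rewrite des_cons; case: J {IH} J0 sm hJ' sd h2 {hJ} => [|j' J] J0 sm hJ' sd h2.
    move: h1; rewrite take_oversize; last by rewrite /= in sm; lia.
    by move/(sortedP 0) => /(_ i.-1); rewrite prednK; lia.
  rewrite inE; case: (ltngtP i j) => //= ij.
    move: h1 => /(sortedP 0) /(_ i.-1); rewrite prednK; last lia.
    rewrite size_takel; last by rewrite su; lia.
    by rewrite !nth_take //; lia.
  have -> : i = j + (i - j) by lia.
  rewrite mem_map; last exact: addnI.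
  apply: h2; first lia.
  have [e1 e2] : j + (i - j) = i /\ j + (i - j).-1 = i.-1 by lia.
  by rewrite !nth_drop e1 e2.
split.
  apply/(sortedP 0) => i; rewrite size_takel; last by rewrite su; lia.
  move=> hi; rewrite !nth_take // ?(ltnW hi) // leqNgt; apply/negP => lt.
  have im : 0 < i.+1 < m by lia.
  have := h _ im lt; rewrite des_cons.
  case: J {IH} J0 sm hJ' sd {h hJ} => [|j' J] J0 sm hJ' sd //.
  by rewrite inE => /orP[/eqP|/mapP[d _]]; lia.
apply/(IH _ _ hJ' sd) => i hi; rewrite !nth_drop => lt.
have im : 0 < j + i < m by lia.
have e : (j + i).-1 = j + i.-1 by lia.
have := h _ im; rewrite e des_cons => /(_ lt).
case: J {IH} J0 sm hJ' sd hi {h hJ} => [|j' J] J0 sm hJ' sd hi //.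
rewrite inE => /orP[|]; first by move/eqP; lia.
by rewrite mem_map //; exact: addnI.
Qed.

(** Recoils of [s] are descents of its inverse, and these must be block ends of [J]. *)
Lemma finer_recoil J s : is_comp n J -> finer J (recoil s) = Jsorted J (iword s).
Proof.
move=> hJ; rewrite /recoil; set F := filter _ _.
have hF : all (fun f => 0 < f < n) F.
  by apply/allP => f; rewrite mem_filter mem_iota; lia.
have [dE _] := des_comp_of_des hF.
rewrite /finer dE all_sort.
have key (i : 'I_n) (i' : 'I_n) : val i' = i.-1 ->
    [exists p : 'I_n, exists p' : 'I_n,
        (p < p') && (val (s p) == i) && (val (s p') == i.-1)] =
    (nth 0 (iword s) i < nth 0 (iword s) i').
  move=> ii'; rewrite !nth_iword ltnS; apply/existsP/idP.
    case=> p /existsP[p' /andP[/andP[pp /eqP/val_inj e]]].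
    by rewrite -ii' -e => /eqP/val_inj <-; rewrite !permK.
  move=> h; exists (s^-1 i)%g; apply/existsP; exists (s^-1 i')%g.
  by rewrite h !permKV ii' !eqxx.
apply/allP/(Jsorted_des hJ (size_iword s)) => [h i hi lt|h i].
  apply: h; rewrite mem_undup mem_filter mem_iota.
  have i1 : i < n by lia.
  have i2 : i.-1 < n by lia.
  by rewrite (key (Ordinal i1) (Ordinal i2)) //= lt /=; lia.
rewrite mem_undup mem_filter mem_iota => /andP[+ hi].
have i1 : i < n by lia.
have i2 : i.-1 < n by lia.
by rewrite (key (Ordinal i1) (Ordinal i2)) //= => lt; apply: h => //; lia.
Qed.

End Perm.

(** * Coefficients of L_I and the final comparison *)

Lemma cbound_des n H x : is_comp n H -> x < n ->
  cbound (fun m => n - m \in des H) x = count (fun a => n - x <= a) (des H).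
Proof.
move=> hH xn; have := des_sorted hH; rewrite ltn_sorted_uniq_leq => /andP[uH _].
(* The reflection by [subn n] matches the elements of the predicate up to [x] with the descents of
   [H] from [n - x] on. *)
rewrite /cbound -!size_filter -(size_map (subn n)); apply/perm_size/uniq_perm.
- rewrite map_inj_in_uniq ?filter_uniq ?iota_uniq // => a b.
  by rewrite !mem_filter !mem_iota; lia.
- by rewrite filter_uniq.
move=> a; rewrite mem_filter; apply/mapP/andP => [[m + ->]|[h aH]].
  by rewrite mem_filter mem_iota => /andP[-> h]; split=> //; lia.
have := allP (des_bound hH) _ aH => ab.
exists (n - a); last lia.
by rewrite mem_filter mem_iota subKn ?aH; lia.
Qed.

Local Open Scope ring_scope.

(** The descents of [LC s] are the reflected elements of [S], so [H] is finer than [LC s] exactly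
    when [S] lies in [D], and st is counted by [cbound]. *)
Lemma LJ_LC (K : fieldType) n H (s : 'S_n) : is_comp n H ->
  let D := (fun m => (n - m)%N \in des H) in let S := LCrec (lehmer s) in
  LJ K (LC s) H =
  if all D S then q K ^+ (\sum_(x <- S) cbound D x)%N else 0.
Proof.
move=> hH D S; have [_ _ pS] := LC_spec s.
rewrite /LJ /finer (perm_all _ pS) all_map; congr (if _ then q K ^+ _ else _).
rewrite st_sum (perm_big _ pS) big_map; apply: eq_big_seq => x xS.
have [_ /allP /(_ x xS)] := LCrec_ok (lehmer_is_code s).1.
by rewrite size_lehmer => hx; rewrite cbound_des //; case/andP: hx.
Qed.

(* S^J(q) = sum_I E_I^J(q) L_I(q), with
   E_I^J(q) = q^{-maj(bar I)} sum_{σ in PP(I,J)} q^{inv σ};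
   compared coefficientwise in the Psi basis (at every composition H of n). *)
Theorem mainTheorem6 (K : fieldType) (charK : [pchar K] =i pred0)
  (n : nat) (J : seq nat) (HJ : is_comp n J) (H : seq nat) (HH : is_comp n H) :
  SJ K J H =
  \sum_(I <- comps n)
     (q K ^- maj (crev I) * \sum_(s in PP n I J) q K ^+ inv_perm s) * LJ K I H.
Proof.
have sJ : sumn J = n by case/andP: HJ => _ /eqP.
pose D m := (n - m)%N \in des H.
have D0 : D 0%N = false.
  by apply/negP; rewrite /D subn0 => /(allP (des_bound HH)); rewrite ltnn andbF.
(* Both sides are brought to one sum over the permutations whose inverse is nondecreasing on the
   blocks of [J], with [I] read off as [LC s]. *)
transitivity (\sum_(s : 'S_n | Jsorted J (iword s))
    q K ^- maj (crev (LC s)) * q K ^+ inv_perm s * LJ K (LC s) H).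
  rewrite /SJ sJ zetaE // -/D.
  have -> : \sum_(d <- codes (cbound D) n) Sprod K J (decode D d) =
      \sum_(d <- codes (cbound D) n) if Jsorted J d then q K ^+ sumn d else 0.
    apply: eq_big_seq => d; rewrite mem_codes => /andP[/eqP sd hd].
    rewrite SprodE ?size_decode ?sJ //; last first.
      by apply/packedP; exists (nletters D (size d)); exact: decode_mem.
    by rewrite -Jsorted_code sinvE code_decode.
  (* From codes of packed words to Lehmer codes, then to permutations. *)
  rewrite -big_compress -(perm_big _ (lehmer_perm_eq n)) big_map.
  rewrite big_mkcond [RHS]big_mkcond; apply: eq_bigr => s _.
  have hc := (lehmer_is_code s).1; rewrite LJ_LC //=.
  case: ifP => SD; last by rewrite mulr0 if_same.
  rewrite Jsorted_compress // Jsorted_code; case: ifP => // _.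
  have [_ -> _] := LC_spec s; rewrite inv_permE.
  (* The weight identity turns inv + st into the compressed weight plus maj, and the negative power
     cancels maj. *)
  rewrite -mulrA -exprD -(compress_weight hc SD) exprD mulrCA mulVf ?mulr1 //.
  by rewrite expf_neq0 ?q_neq0.
under [RHS]eq_bigr => I _ do rewrite mulr_sumr mulr_suml big_mkcond.
rewrite exchange_big big_mkcond /=; apply: eq_bigr => s _.
have [cLC _ _] := LC_spec s.
(* For a given [s], only the composition [LC s] contributes, and it occurs exactly once in the
   list. *)
rewrite (bigD1_seq (LC s)) ?compsF_mem ?compsF_uniq //= [X in _ + X]big1_seq ?addr0.
  by rewrite inE eqxx finer_recoil.
by move=> I /andP[IL _]; rewrite inE eq_sym (negPf IL).
Qed.
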